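(* For $n \geq 1$, let $d_{e}(n)$ be the number of partitions of $n$ in which exactly one even part is repeated (every other even part appears at most once) and odd parts appear with unrestricted multiplicity; let $d_{o}(n)$ be the number of partitions of $n$ in which exactly one odd part is repeated (every other odd part appears at most once) and even parts appear with unrestricted multiplicity. For $i \in \{0,2\}$, let $f_{i}(n)$ be the number of partitions of $n$ in which the set of (distinct values of) parts congruent to $i \pmod{4}$ has exactly one element. Then for all $n \geq 1$, $$d_{e}(n) = f_{0}(n) \quad\text{and}\quad d_{o}(n) = f_{2}(n).$$
   Context: A part is ''repeated'' if it appears at least twice. *)

(* Defs.v *)
From HB Require Import structures.
From mathcomp Require Import all_boot.

Set Implicit Arguments.
Unset Strict Implicit.
Unset Printing Implicit Defensive.

Definition is_intpart (n : nat) (s : seq nat) : bool :=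
  [&& sorted geq s, 0 \notin s & sumn s == n].

Record intpart (n : nat) : Type := IntPart {
  parts :> seq nat;
  _ : is_intpart n parts
}.

HB.instance Definition _ (n : nat) := [isSub for @parts n].
HB.instance Definition _ (n : nat) := [Countable of intpart n by <:].

Lemma size_intpart (n : nat) (p : intpart n) : size p <= n.
Proof.
case: p => s /= /and3P[_ s0 /eqP <-] {n}.
elim: s s0 => //= x s IHs; rewrite inE eq_sym => /norP[x0 /IHs les].
by rewrite -add1n leq_add // lt0n.
Qed.

Lemma intpart_leq (n : nat) (p : intpart n) (i : nat) : i \in parts p -> i <= n.
Proof.
case: p => s /= /and3P[_ _ /eqP <-] {n}.
elim: s => //= x s IHs; rewrite inE => /predU1P[->|/IHs lei].
  exact: leq_addr.
exact: leq_trans lei (leq_addl _ _).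
Qed.

(* A partition of n has at most n parts, each at most n, so it embeds into the
   finite type of sequences of length at most n over {0, ..., n}; this only
   serves to make [intpart n] a finite type. *)
Definition intpart_code (n : nat) (p : intpart n) : n.-bseq 'I_n.+1 :=
  insub_bseq n [seq inord i | i <- parts p].

Definition intpart_decode (n : nat) (b : n.-bseq 'I_n.+1) :
  option (intpart n) := insub [seq val i | i <- b].

Lemma intpart_codeK (n : nat) : pcancel (@intpart_code n) (@intpart_decode n).
Proof.
move=> p; rewrite /intpart_decode /intpart_code /insub_bseq insubdK; last first.
  by rewrite unfold_in /= size_map size_intpart.
rewrite -map_comp map_id_in ?valK // => i ip /=.
by rewrite inordK // ltnS (intpart_leq ip).
Qed.

HB.instance Definition _ (n : nat) :=
  isFinite.Build (intpart n) (pcan_enumP (@intpart_codeK n)).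

Definition repeated (s : seq nat) (i : nat) : bool := 1 < count_mem i s.

(* [undup p] lists the distinct values of the parts of [p]. *)
Definition d_e (n : nat) : nat :=
  #|[set p : intpart n |
      size [seq i <- undup p | ~~ odd i & repeated p i] == 1]|.

Definition d_o (n : nat) : nat :=
  #|[set p : intpart n |
      size [seq i <- undup p | odd i & repeated p i] == 1]|.

Definition f (r n : nat) : nat :=
  #|[set p : intpart n | size [seq i <- undup p | i == r %[mod 4]] == 1]|.

(* Main.v *)
Require Import Defs.
From mathcomp Require Import all_boot.
From mathcomp Require Import zify.

(** Write [v] for the 2-adic valuation and [m x] for the multiplicity of the
    part [x].  For fixed [k], replace for every [x] with [v x = k] the pair
    [(m x, m (2 x))] by [(2 m (2 x) + (m x mod 2), m x / 2)].  This is a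
    weight-preserving involution on partitions, after which [2 x] is a part iff
    [x] was repeated.  It therefore turns the number of repeated parts of
    valuation in [[lo, k]] plus the number of distinct parts of valuation in
    [[k + 2, hi)] into the same statistic with [k - 1] in place of [k].  Taking
    [(lo, hi) = (0, 2)] and [k = 0] yields the identity for odd repeated parts;
    iterating over all [k >= lo = 1] yields the one for even repeated parts. *)

Notation v2 := (logn 2).

(** * Valuations and sums over pairs [x], [x.*2] *)

Lemma v2_double x : 0 < x -> v2 (x.*2) = (v2 x).+1.
Proof. by move=> x0; rewrite -mul2n lognM // (@pfactorK 2 1). Qed.

Lemma v2_odd x : odd x -> v2 x = 0.
Proof. by move=> ox; apply/eqP; rewrite -leqn0 leqNgt logn_gt0 mem_primes /= dvdn2 ox andbF. Qed.

Lemma v2S_half {x k} : v2 x = k.+1 -> x = x./2.*2 /\ v2 x./2 = k.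
Proof.
move=> vx; have ox : ~~ odd x by apply/negP => /v2_odd; rewrite vx.
have ex : x = x./2.*2 by rewrite -[LHS]odd_double_half (negPf ox).
split=> //; move: vx; rewrite {1}ex; case: (posnP x./2) => [->|h0]; first by rewrite logn0.
by rewrite v2_double // => -[].
Qed.

Lemma big_double_range N (F : nat -> nat) :
  \sum_(0 <= x < N.*2) F x = \sum_(0 <= y < N) (F y.*2 + F y.*2.+1).
Proof.
elim: N => [|N IHN]; first by rewrite !big_geq.
by rewrite doubleS !big_nat_recr //= IHN addnA.
Qed.

Lemma sum_widen0 n N (F : nat -> nat) : n <= N ->
  (forall x, n <= x -> F x = 0) -> \sum_(0 <= x < n) F x = \sum_(0 <= x < N) F x.
Proof.
move=> leN F0; rewrite [RHS](big_cat_nat_idem _ (leq0n n) leN) //=.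
by rewrite [X in _ + X]big_nat_cond [X in _ + X]big1 ?addn0 // => i /andP[/andP[/F0]].
Qed.

(** Doubling is a bijection from positive numbers of valuation [k] to those of valuation [k.+1], so
    each term of the latter kind is charged to its half. Sums before and after [halving] can then be
    compared pair by pair. *)
Lemma sum_v2_pairs k n (F : nat -> nat) :
  F 0 = 0 -> (forall x, n < x -> F x = 0) ->
  \sum_(0 <= x < n.+1) F x =
  \sum_(0 <= x < n.+1) (if v2 x == k then F x + F x.*2
                        else if v2 x == k.+1 then 0 else F x).
Proof.
move=> F00 Fn.
have E : \sum_(0 <= x < n.+1) (if v2 x == k.+1 then F x else 0) =
         \sum_(0 <= x < n.+1) (if v2 x == k then F x.*2 else 0).
  (* The range is doubled so that its even members are exactly the [x.*2] with [x <= n]; odd members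
     have valuation 0, never [k.+1]. *)
  rewrite (@sum_widen0 _ n.+1.*2) => [||x /Fn ->]; [|by lia|by case: ifP].
  rewrite big_double_range; apply: eq_bigr => x _.
  rewrite (@v2_odd x.*2.+1) /= ?odd_double // addn0.
  by case: (posnP x) => [->|x0]; [rewrite F00 !if_same | rewrite v2_double].
transitivity (\sum_(0 <= x < n.+1) (if v2 x == k.+1 then F x else 0) +
  \sum_(0 <= x < n.+1) (if v2 x == k.+1 then 0 else F x)).
  by rewrite -big_split; apply: eq_bigr => x _ /=; case: ifP; rewrite ?addn0.
rewrite E -big_split; apply: eq_bigr => x _ /=.
case: (eqVneq (v2 x) k) => [->|_ //].
by rewrite ltn_eqF // addnC.
Qed.

Lemma mul_le_eq0 {n x c} : x * c <= n -> n < x -> c = 0.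
Proof. by case: c => // c; rewrite mulnS; lia. Qed.

(** * The halving involution on multiplicity functions *)

Definition weight n (m : nat -> nat) := \sum_(0 <= x < n.+1) x * m x.

(** Since [v2 0 = 0], the case [k = 0] also catches [x = 0], which is its own double; hence the
    recurring hypothesis [m 0 = 0]. *)
Definition halving k (m : nat -> nat) x :=
  if v2 x == k then (m x.*2).*2 + odd (m x)
  else if v2 x == k.+1 then (m x./2)./2 else m x.

Lemma halving_same k m x : v2 x = k -> halving k m x = (m x.*2).*2 + odd (m x).
Proof. by rewrite /halving => ->; rewrite eqxx. Qed.

Lemma halving_double k m x : 0 < x -> v2 x = k -> halving k m x.*2 = (m x)./2.
Proof.
by move=> x0 vx; rewrite /halving v2_double // vx eqxx gtn_eqF // doubleK.
Qed.

Lemma halving_other k m x : v2 x != k -> v2 x != k.+1 -> halving k m x = m x.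
Proof. by rewrite /halving => /negPf -> /negPf ->. Qed.

Lemma halving0 k m : m 0 = 0 -> halving k m 0 = 0.
Proof. by rewrite /halving => /= ->; rewrite !if_same. Qed.

Lemma halvingK k m : m 0 = 0 -> halving k (halving k m) =1 m.
Proof.
move=> m0 x; have [->|x0] := posnP x; first by rewrite !halving0.
have [vx|vx] := eqVneq (v2 x) k.
  rewrite halving_same // halving_double // halving_same // oddD odd_double.
  by rewrite oddb addnC odd_double_half.
have [/v2S_half[ex vh]|vx'] := eqVneq (v2 x) k.+1; last by rewrite !halving_other.
have h0 : 0 < x./2 by lia.
rewrite ex halving_double // halving_same // -ex.
by rewrite addnC half_bit_double.
Qed.

(** The bound is on [x * m x], not merely on the support: a new part [x] of valuation [k.+1] needs
    two copies of [x./2], of total size [x], so [x <= n]. *)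
Lemma halving_gtn k m n : (forall x, x * m x <= n) ->
  forall x, n < x -> halving k m x = 0.
Proof.
move=> mn x nx.
have m0 y : n < y -> m y = 0 := mul_le_eq0 (mn y).
rewrite /halving; case: eqP => _; first by rewrite !m0 //; lia.
case: eqP => [/v2S_half[ex _]|_]; last exact: m0.
by have := mn x./2; nia.
Qed.

Lemma weight_halving k m n : m 0 = 0 -> (forall x, x * m x <= n) ->
  weight n (halving k m) = weight n m.
Proof.
move=> m0 mn.
rewrite /weight (@sum_v2_pairs k) ?mul0n // => [|x nx]; last first.
  by rewrite (@halving_gtn k m n) // muln0.
rewrite [RHS](@sum_v2_pairs k) ?mul0n // => [|x nx]; last by rewrite (mul_le_eq0 (mn x)) ?muln0.
apply: eq_bigr => x _; case: eqP => [vx|/eqP vx]; last first.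
  by case: eqP => // /eqP vx'; rewrite halving_other.
have [->|x0] := posnP x; first by rewrite !mul0n.
rewrite halving_same // halving_double //.
by rewrite -{3}[m x]odd_double_half; lia.
Qed.

Definition stat lo hi k n (m : nat -> nat) :=
  \sum_(0 <= x < n.+1)
    ((lo <= v2 x < k) && (1 < m x) || (k < v2 x < hi) && (0 < m x)).

(** Valuation [k] is the gap in [stat] at [k], and [k.+1] the gap at [k.+1]. So a pair [x], [x.*2]
    with [v2 x = k] contributes only through [x.*2] on the left and only through [x] on the right,
    and [(m x)./2] is positive iff [1 < m x]. *)
Lemma stat_halving lo hi k n m : lo <= k -> k.+1 < hi ->
  m 0 = 0 -> (forall x, x * m x <= n) ->
  stat lo hi k n (halving k m) = stat lo hi k.+1 n m.
Proof.
move=> lok khi m0 mn.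
rewrite /stat (@sum_v2_pairs k) ?halving0 ?andbF // => [|x nx]; last first.
  by rewrite (@halving_gtn k m n) // !andbF.
rewrite [RHS](@sum_v2_pairs k) ?m0 ?andbF // => [|x nx]; last first.
  by rewrite (mul_le_eq0 (mn x)) // !andbF.
apply: eq_bigr => x _; case: eqP => [vx|/eqP vx]; last first.
  case: eqP => // /eqP vx'; rewrite halving_other //.
  by congr (nat_of_bool (_ && _ || _ && _)); lia.
have [->|x0] := posnP x; first by rewrite /= halving0 // m0 !andbF.
rewrite halving_double // v2_double // vx.
by rewrite half_gt0; lia.
Qed.

(** * Transfer to partitions of [n] *)

Section Multiplicities.

Variable n : nat.
Implicit Type p : intpart n.

Definition mult p x := count_mem x p.

Lemma intpartP p : is_intpart n p. Proof. by case: p. Qed.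

Lemma mult0 p : mult p 0 = 0.
Proof. by case/and3P: (intpartP p) => _ /count_memPn. Qed.

Lemma mult_gtn p x : n < x -> mult p x = 0.
Proof. by move=> nx; apply/count_memPn/negP => /intpart_leq; rewrite leqNgt nx. Qed.

Lemma sumn_count s N : {in s, forall x, x < N} ->
  sumn s = \sum_(0 <= x < N) x * count_mem x s.
Proof.
elim: s => [_|y s IHs sN] /=; first by rewrite big1 // => x; rewrite muln0.
rewrite IHs => [|x xs]; last by apply: sN; rewrite inE xs orbT.
under [RHS]eq_bigr do rewrite mulnDr.
rewrite big_split /=; congr (_ + _).
rewrite (bigD1_seq y) ?iota_uniq //=; last first.
  by rewrite mem_index_iota sN // inE eqxx.
by rewrite eqxx muln1 big1 ?addn0 // => x /negPf; rewrite eq_sym => ->; rewrite muln0.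
Qed.

Lemma weight_mult p : weight n (mult p) = n.
Proof.
case/and3P: (intpartP p) => _ _ /eqP sum_p.
by rewrite -[RHS]sum_p (@sumn_count p n.+1) // => x /intpart_leq.
Qed.

Lemma mult_le p x : x * mult p x <= n.
Proof.
have [nx|xn] := ltnP n x; first by rewrite mult_gtn ?muln0.
rewrite -[leqRHS](weight_mult p) /weight (bigD1_seq x) ?iota_uniq ?leq_addr //=.
by rewrite mem_index_iota.
Qed.

Lemma mult_inj p q : mult p =1 mult q -> p = q.
Proof.
move=> pq; apply: val_inj; case/and3P: (intpartP p) (intpartP q) => [sp _ _].
case/and3P => sq _ _; apply: (@sorted_eq _ geq) => //.
- by move=> x y z /= ? ?; lia.
- by move=> x y /= ?; lia.
by apply/allP => x _; apply/eqP; exact: pq.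
Qed.

Definition expand (g : nat -> nat) :=
  sort geq (flatten [seq nseq (g x) x | x <- iota 0 n.+1]).

Lemma count_expand g x :
  (forall y, n < y -> g y = 0) -> count_mem x (expand g) = g x.
Proof.
move=> gn; rewrite (permP (permEl (perm_sort _ _))) count_flatten -map_comp.
rewrite sumnE big_map.
under eq_bigr do rewrite /= count_nseq.
have [nx|xn] := ltnP n x.
  rewrite gn // big_seq big1 // => y; rewrite mem_iota /= => yn.
  by case: eqP => // yx; lia.
rewrite (bigD1_seq x) ?iota_uniq ?mem_iota //= eqxx mul1n big1 ?addn0 //.
by move=> y /negPf ->.
Qed.

Lemma expandP g : g 0 = 0 -> (forall y, n < y -> g y = 0) -> weight n g = n ->
  is_intpart n (expand g).
Proof.
move=> g0 gn gw; apply/and3P; split.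
- by apply: sort_sorted => x y /=; exact: leq_total.
- by apply/count_memPn; rewrite count_expand.
rewrite (@sumn_count _ n.+1).
  by under eq_bigr do rewrite count_expand //; rewrite -[X in _ == X]gw.
move=> x; rewrite ltnS leqNgt; apply: contraTN => nx.
by apply/count_memPn; rewrite count_expand ?gn.
Qed.

Definition intpart_halving k p : intpart n := insubd p (expand (halving k (mult p))).

Lemma mult_halving k p : mult (intpart_halving k p) =1 halving k (mult p).
Proof.
move=> x; have gn := @halving_gtn k _ _ (mult_le p).
rewrite /mult /intpart_halving; transitivity (count_mem x (expand (halving k (mult p)))).
  (* Preservation of the weight makes the expanded sequence a partition of [n], so [insubd] returns
     it rather than its default [p]. *)
  congr (count _ _); apply: insubdK; apply: expandP => //.
    by rewrite halving0 // mult0.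
  by rewrite weight_halving ?mult0 ?weight_mult //; exact: mult_le.
by rewrite count_expand.
Qed.

Lemma eq_halving k {m1 m2} : m1 =1 m2 -> halving k m1 =1 halving k m2.
Proof. by move=> e x; rewrite /halving !e. Qed.

Lemma intpart_halvingK k : involutive (intpart_halving k).
Proof.
move=> p; apply: mult_inj => x.
by rewrite mult_halving (eq_halving k (mult_halving k p)) halvingK ?mult0.
Qed.

Lemma card_statS lo hi k : lo <= k -> k.+1 < hi ->
  #|[set p | stat lo hi k n (mult p) == 1]| =
  #|[set p | stat lo hi k.+1 n (mult p) == 1]|.
Proof.
move=> lok khi; rewrite -(card_preimset _ (inv_inj (intpart_halvingK k))).
apply: eq_card => p; rewrite !inE.
rewrite -(@stat_halving lo hi k) ?mult0 //; last exact: mult_le.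
by congr (_ == 1); apply: eq_bigr => x _; rewrite mult_halving.
Qed.

Lemma card_stat lo hi k : lo <= k < hi ->
  #|[set p | stat lo hi k n (mult p) == 1]| =
  #|[set p | stat lo hi lo n (mult p) == 1]|.
Proof.
elim: k => [|k IHk]; first by rewrite leqn0 => /andP[/eqP ->].
case/andP; rewrite leq_eqVlt => /predU1P[->//|lok] khi.
by rewrite -card_statS // IHk //; lia.
Qed.

Lemma size_filter_undup p (P : pred nat) :
  size [seq x <- undup p | P x] = \sum_(0 <= x < n.+1) (P x && (0 < mult p x)).
Proof.
rewrite size_filter.
have /permP-> : perm_eq (undup p) [seq x <- index_iota 0 n.+1 | x \in parts p].
  apply: uniq_perm; rewrite ?undup_uniq ?filter_uniq ?iota_uniq // => x.
  rewrite mem_undup mem_filter mem_index_iota /=.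
  by case: (boolP (x \in _)) => //= /intpart_leq; rewrite ltnS => ->.
rewrite count_filter -sum1_count big_mkcond; apply: eq_bigr => x _ /=.
by rewrite /mult -has_count has_pred1; case: ifP.
Qed.

Lemma card_size_filter lo hi k (P : intpart n -> pred nat) :
  (forall p x, 0 < x <= n -> P p x && (0 < mult p x) =
    (lo <= v2 x < k) && (1 < mult p x) || (k < v2 x < hi) && (0 < mult p x)) ->
  #|[set p : intpart n | size [seq x <- undup p | P p x] == 1]| =
  #|[set p | stat lo hi k n (mult p) == 1]|.
Proof.
move=> PE; apply: eq_card => p; rewrite !inE size_filter_undup; congr (_ == 1).
apply: eq_big_nat => x /= xn; congr nat_of_bool.
have [->|x0] := posnP x; first by rewrite mult0 !andbF.
by apply: PE; rewrite x0.
Qed.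

End Multiplicities.

(** * Residues modulo 4 as valuations, and the conclusion *)

Lemma v2_gt0 x : 0 < x -> (0 < v2 x) = ~~ odd x.
Proof. by move=> x0; rewrite logn_gt0 mem_primes x0 /= dvdn2. Qed.

Lemma v2_gt1 x : 0 < x -> (1 < v2 x) = (x == 0 %[mod 4]).
Proof. by move=> x0; rewrite -(@pfactor_dvdn 2 2) // /dvdn mod0n. Qed.

Theorem theorem5 (n : nat) (hn : 1 <= n) : d_e n = f 0 n /\ d_o n = f 2 n.
Proof.
split.
(* Parts have valuation at most [n], so with [k = n.+1] the first clause of [stat] sees every even
   part and the second none. The choice [hi = n.+2] keeps [k < hi]; at [k = 1] what remains is
   [1 < v2 x]. *)
- rewrite /d_e /f (@card_size_filter n 1 n.+2 n.+1) => [|p x /andP[x0 xn]]; last first.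
    have vn : v2 x <= n by rewrite (leq_trans _ xn) // ltnW // ltn_logl.
    by rewrite v2_gt0 // /repeated -/(mult n p x); case: (odd x) => /=; lia.
  rewrite card_stat ?ltnSn //; apply/esym/card_size_filter => p x /andP[x0 xn].
  have vn : v2 x <= n by rewrite (leq_trans _ xn) // ltnW // ltn_logl.
  by rewrite -v2_gt1 //; lia.
(* At [k = 1] the range [1 < v2 x < 2] is empty, leaving repeated odd parts; at [k = 0] only
   valuation exactly 1 counts. *)
rewrite /d_o /f (@card_size_filter n 0 2 1) => [|p x /andP[x0 xn]]; last first.
  have := v2_gt0 x x0.
  by rewrite /repeated -/(mult n p x); case: (odd x) => /=; lia.
rewrite card_stat //; apply/esym/card_size_filter => p x /andP[x0 xn].
have -> : (x == 2 %[mod 4]) = ~~ odd x && ~~ (x == 0 %[mod 4]) by lia.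
by rewrite -v2_gt0 // -v2_gt1 //; lia.
Qed.
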